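(* Let $A^{*}=\big((A^{*})^{kl}_{\alpha\beta}\big)$ and $B^{*}=\big((B^{*})^{kl}_{\alpha\beta}\big)$ be two fourth-order tensors, with all indices in $\{1,\dots,d\}$, possessing the simple symmetry $$(A^{*})^{kl}_{\alpha\beta}=(A^{*})^{lk}_{\beta\alpha},\qquad (B^{*})^{kl}_{\alpha\beta}=(B^{*})^{lk}_{\beta\alpha}\qquad\text{for all }\alpha,\beta,k,l .$$ They satisfy the same propagation relation (see context) if and only if $$B^{*}-A^{*}=c\,(I\otimes I)+N$$ for some scalar $c\in\mathbb{R}$, where $I$ is the $d\times d$ identity matrix and $N$ is a fourth-order tensor satisfying, on top of the simple symmetry $N^{jl}_{\alpha\beta}=N^{lj}_{\beta\alpha}$ (all indices), the following anti-symmetry property: $$N^{jl}_{\alpha\beta}=-N^{jl}_{\beta\alpha}=-N^{lj}_{\alpha\beta}\quad\text{whenever }(\alpha,\beta)\neq(j,l)\text{ and }(\beta,\alpha)\neq(j,l),$$ $$N^{ii}_{ii}=0\quad\text{for all }i\ (\text{no summation}).$$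
   Context: Summation over repeated indices is used unless stated otherwise; tensors are real. $I\otimes I$ is the fourth-order tensor with entries $(I\otimes I)^{jl}_{\alpha\beta}=\delta_{\alpha j}\delta_{\beta l}$. For a fourth-order tensor $C$ and a unit vector $\hat\eta\in\mathbb{S}^{d-1}\subset\mathbb{R}^d$, $M(\hat\eta,C)$ is the $d\times d$ matrix with entries $M(\hat\eta,C)_{kl}=C^{kl}_{\alpha\beta}\hat\eta_\alpha\hat\eta_\beta$. Bloch spectral data. Let $\mu\in L^\infty(\mathbb{T}^d)$ be a periodic viscosity on the unit torus $\mathbb{T}^d$, bounded below by a positive constant. For $\hat\eta\in\mathbb{S}^{d-1}$ and real $\delta$ near $0$, put $D(\delta\hat\eta)=\nabla+i\delta\hat\eta$ and consider the Stokes eigenvalue problem on $\mathbb{T}^d$: $$-D(\delta\hat\eta)\cdot(\mu D(\delta\hat\eta)\phi)+D(\delta\hat\eta)q+q_0\hat\eta=\lambda\phi,\quad D(\delta\hat\eta)\cdot\phi=0,\quad \hat\eta\cdot\int_{\mathbb{T}^d}\phi\,dy=0,\quad \int_{\mathbb{T}^d}|\phi|^2dy=1,$$ with $\phi\in H^1(\mathbb{T}^d)^d$, $q\in L^2(\mathbb{T}^d)$ of zero mean, $q_0\in\mathbb{C}$, $\lambda\in\mathbb{R}$. There are exactly $d-1$ branches of solutions, analytic in $\delta$, $(\lambda_{m,\hat\eta}(\delta),\phi_{m,\hat\eta}(\cdot;\delta),q_{m,\hat\eta}(\cdot;\delta),q_{0,m,\hat\eta}(\delta))$, $m=1,\dots,d-1$,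 with $\lambda_{m,\hat\eta}(0)=0$, $q_{m,\hat\eta}(\cdot;0)=0$, $q_{0,m,\hat\eta}(0)=0$ and $\phi_{m,\hat\eta}(\cdot;0)=\phi^0_{m,\hat\eta}$ a constant unit vector of $\mathbb{R}^d$; $\{\phi^0_{1,\hat\eta},\dots,\phi^0_{d-1,\hat\eta},\hat\eta\}$ is an orthonormal basis of $\mathbb{R}^d$. Primes denote derivatives in $\delta$. The propagation relation for a tensor $C$ is $$\tfrac12\lambda''_{m,\hat\eta}(0)\,\phi^0_{m,\hat\eta}=\tfrac12 q''_{0,m,\hat\eta}(0)\,\hat\eta+M(\hat\eta,C)\,\phi^0_{m,\hat\eta},\qquad m=1,\dots,d-1,\ \hat\eta\in\mathbb{S}^{d-1}.$$ Two tensors satisfy the same propagation relation when it involves the same spectral data $\lambda''_{m,\hat\eta}(0)$, $q''_{0,m,\hat\eta}(0)$, $\phi^0_{m,\hat\eta}$ for both, i.e. $M(\hat\eta,A^{*})\phi^0_{m,\hat\eta}=M(\hat\eta,B^{*})\phi^0_{m,\hat\eta}$ for all $m=1,\dots,d-1$ and all $\hat\eta\in\mathbb{S}^{d-1}$.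
   Formalization: Anti-symmetry of N is required at all indices except α=β=j=l, rather than only when (α,β)≠(j,l) and (β,α)≠(j,l); as printed, the ''if'' direction fails for d≥2 (e.g. A*=0, B*=N with N^{12}_{12}=N^{21}_{21}=1, other entries 0). *)

(* Defs.v *)
From HB Require Import structures.
From mathcomp Require Import all_boot all_order all_algebra.
From mathcomp Require Import all_classical all_reals all_analysis.
From mathcomp Require Import complex.

Set Implicit Arguments.
Unset Strict Implicit.
Unset Printing Implicit Defensive.

Import Order.TTheory GRing.Theory Num.Theory.
Import numFieldNormedType.Exports.

Local Open Scope classical_set_scope.
Local Open Scope ring_scope.
Local Open Scope complex_scope.

(* Tensors.  [C k l a b] is the entry with upper indices k, l and lower
   indices a, b. *)

Definition tensor4 (R : realType) (d : nat) : Type :=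
  'I_d -> 'I_d -> 'I_d -> 'I_d -> R.

Definition simple_symmetry (R : realType) (d : nat) (C : tensor4 R d) : Prop :=
  forall k l a b : 'I_d, C k l a b = C l k b a.

Definition tensor_II (R : realType) (d : nat) : tensor4 R d :=
  fun j l a b => (a == j)%:R * (b == l)%:R.

(* The exceptional indices of the first clause are those for which both
   (a, b) = (j, l) and (b, a) = (j, l), i.e. a = b = j = l; the second clause
   deals with exactly those.  Exempting every index with (a, b) = (j, l) or
   (b, a) = (j, l) would leave N j l j l and N j l l j with j <> l
   unconstrained, and M(eta, N) phi would then not vanish for phi orthogonal
   to eta. *)
Definition antisymmetry_property (R : realType) (d : nat) (N : tensor4 R d) :
    Prop :=
  (forall j l a b : 'I_d, ~ ((a, b) = (j, l) /\ (b, a) = (j, l)) ->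
     N j l a b = - N j l b a /\ N j l a b = - N l j a b) /\
  (forall i : 'I_d, N i i i i = 0).

Definition dotv (R : realType) (d : nat) (u v : 'cV[R]_d) : R :=
  \sum_(i < d) u i 0 * v i 0.

Definition unit_sphere (R : realType) (d : nat) : set 'cV[R]_d :=
  [set eta | dotv eta eta = 1].

Definition Mmx (R : realType) (d : nat) (eta : 'cV[R]_d) (C : tensor4 R d) :
    'M[R]_d :=
  \matrix_(k < d, l < d) \sum_(a < d) \sum_(b < d)
    C k l a b * eta a 0 * eta b 0.

(* The unit torus.  Functions on it are represented by functions on [0, 1]^d,
   that is, by functions on d-tuples considered up to a null set of the uniform
   probability on the cube. *)

Definition cons_tuple (R : realType) (n : nat)
    (p : measurableTypeR R * n.-tuple R) : n.+1.-tuple R :=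
  [tuple of p.1 :: p.2].

Lemma measurable_cons_tuple (R : realType) (n : nat) :
  measurable_fun [set: measurableTypeR R * n.-tuple R] (@cons_tuple R n).
Proof.
apply: measurable_cons; last exact: measurable_snd.
exact: (@measurable_fst _ _ (measurableTypeR R) _).
Qed.

HB.instance Definition _ (R : realType) (n : nat) :=
  isMeasurableFun.Build _ _ _ _ (@cons_tuple R n)
    (@measurable_cons_tuple R n).

Fixpoint torus_measure (R : realType) (d : nat) : probability (d.-tuple R) R :=
  match d return probability (d.-tuple R) R with
  | 0 => dirac ([tuple] : 0.-tuple R)
  | n.+1 => distribution (uniform_prob (@ltr01 R) \x torus_measure R n)%E
              (@cons_tuple R n)
  end.

Definition cintegral (R : realType) (d : nat) (f : d.-tuple R -> R[i]) : R[i] :=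
  (\int[torus_measure R d]_y complex.Re (f y)) +i*
  (\int[torus_measure R d]_y complex.Im (f y)).

Definition L2_sqnorm (R : realType) (d : nat) (f : d.-tuple R -> R[i]) :
    \bar R :=
  (\int[torus_measure R d]_y
     (complex.Re (f y) ^+ 2 + complex.Im (f y) ^+ 2)%:E)%E.

Definition in_L2 (R : realType) (d : nat) (f : d.-tuple R -> R[i]) : Prop :=
  [/\ measurable_fun [set: d.-tuple R] (fun y => complex.Re (f y)),
      measurable_fun [set: d.-tuple R] (fun y => complex.Im (f y)) &
      (L2_sqnorm f < +oo)%E].

Definition partial (R : realType) (d : nat) (j : 'I_d) (psi : 'rV[R]_d -> R) :
    'rV[R]_d -> R :=
  'D_(delta_mx 0 j) psi.

Definition smooth_periodic (R : realType) (d : nat) (psi : 'rV[R]_d -> R) :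
    Prop :=
  (forall s : seq 'I_d,
     let g := foldr (@partial R d) psi s in
     continuous g /\ forall j x, derivable g x (delta_mx 0 j)) /\
  (forall j x, psi (x + delta_mx 0 j) = psi x).

Definition torus_point (R : realType) (d : nat) (y : d.-tuple R) : 'rV[R]_d :=
  \row_i tnth y i.

(* [u] is square integrable and so is its weak derivative [g] along e_j. *)
Definition weak_partial (R : realType) (d : nat) (j : 'I_d)
    (u g : d.-tuple R -> R[i]) : Prop :=
  [/\ in_L2 u, in_L2 g &
      forall psi : 'rV[R]_d -> R, smooth_periodic psi ->
        cintegral (fun y => u y * (partial j psi (torus_point y))%:C) =
        - cintegral (fun y => g y * (psi (torus_point y))%:C)].

Definition viscosity (R : realType) (d : nat) (mu : d.-tuple R -> R) : Prop :=
  measurable_fun [set: d.-tuple R] mu /\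
  exists c M : R, 0 < c /\
    {ae torus_measure R d, forall y, c <= mu y <= M}.

(* The formal transpose of -(d_j + i xi_j) applied to a test function. *)
Definition shifted_partial (R : realType) (d : nat) (xi : 'cV[R]_d) (j : 'I_d)
    (psi : 'rV[R]_d -> R) (x : 'rV[R]_d) : R[i] :=
  (partial j psi x)%:C - 'i * (xi j 0)%:C * (psi x)%:C.

(* The Stokes eigenvalue problem for D = grad + i delta eta; the momentum
   equation is in the sense of distributions and [dphi j k] is the derivative
   of [phi k] along e_j. *)
Record stokes_eigen (R : realType) (d : nat) (mu : d.-tuple R -> R)
    (eta : 'cV[R]_d) (delta lambda : R) (phi : 'I_d -> d.-tuple R -> R[i])
    (dphi : 'I_d -> 'I_d -> d.-tuple R -> R[i]) (q : d.-tuple R -> R[i])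
    (q0 : R[i]) : Prop := StokesEigen {
  stokes_grad : forall j k, weak_partial j (phi k) (dphi j k);
  stokes_pressure : in_L2 q;
  stokes_pressure_mean : cintegral q = 0;
  stokes_momentum : forall (psi : 'rV[R]_d -> R) (k : 'I_d),
    smooth_periodic psi ->
    \sum_(j < d) cintegral (fun y =>
        (mu y)%:C * (dphi j k y + 'i * (delta * eta j 0)%:C * phi k y) *
        shifted_partial (delta *: eta) j psi (torus_point y))
    - cintegral (fun y =>
        q y * shifted_partial (delta *: eta) k psi (torus_point y))
    + q0 * (eta k 0)%:C * cintegral (fun y => (psi (torus_point y))%:C)
    = lambda%:C * cintegral (fun y => phi k y * (psi (torus_point y))%:C);
  stokes_divergence : {ae torus_measure R d, forall y,
    \sum_(k < d) (dphi k k y + 'i * (delta * eta k 0)%:C * phi k y) = 0};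
  stokes_mean : \sum_(k < d) (eta k 0)%:C * cintegral (phi k) = 0;
  stokes_normalized : (\sum_(k < d) L2_sqnorm (phi k) = 1)%E
}.

Definition analytic_at0 (R : realType) (f : R -> R) : Prop :=
  exists (r : R) (a : nat -> R), 0 < r /\
    forall delta, `|delta| < r -> pseries a delta @ \oo --> f delta.

Definition L2_analytic_at0 (R : realType) (d : nat)
    (f : R -> d.-tuple R -> R[i]) : Prop :=
  exists (r : R) (a : nat -> d.-tuple R -> R[i]),
    [/\ 0 < r, (forall n, in_L2 (a n)) &
        forall delta, `|delta| < r ->
          L2_sqnorm (fun y =>
            f delta y - \sum_(0 <= i < n) (delta ^+ i)%:C * a i y)
            @[n --> \oo] --> 0%E].

(* Analyticity of the velocity with values in H^1 is expressed by that of the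
   velocity and of its gradient with values in L^2. *)
Record bloch_branch (R : realType) (d : nat) (mu : d.-tuple R -> R)
    (eta : 'cV[R]_d) : Type := BlochBranch {
  branch_lambda : R -> R;
  branch_phi : R -> 'I_d -> d.-tuple R -> R[i];
  branch_dphi : R -> 'I_d -> 'I_d -> d.-tuple R -> R[i];
  branch_q : R -> d.-tuple R -> R[i];
  branch_q0 : R -> R[i];
  branch_phi0 : 'cV[R]_d;
  branch_eigen : \forall delta \near (0 : R),
    stokes_eigen mu eta delta (branch_lambda delta) (branch_phi delta)
      (branch_dphi delta) (branch_q delta) (branch_q0 delta);
  branch_lambda_analytic : analytic_at0 branch_lambda;
  branch_phi_analytic : forall k,
    L2_analytic_at0 (fun delta => branch_phi delta k);
  branch_dphi_analytic : forall j k,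
    L2_analytic_at0 (fun delta => branch_dphi delta j k);
  branch_q_analytic : L2_analytic_at0 branch_q;
  branch_q0_analytic :
    analytic_at0 (fun delta => complex.Re (branch_q0 delta)) /\
    analytic_at0 (fun delta => complex.Im (branch_q0 delta));
  branch_lambda_at0 : branch_lambda 0 = 0;
  branch_q_at0 : {ae torus_measure R d, forall y, branch_q 0 y = 0};
  branch_q0_at0 : branch_q0 0 = 0;
  branch_phi_at0 : {ae torus_measure R d, forall y, forall k : 'I_d,
    branch_phi 0 k y = (branch_phi0 k 0)%:C}
}.

Record bloch_data (R : realType) (d : nat) (mu : d.-tuple R -> R) : Type :=
    BlochData {
  branch : forall eta : 'cV[R]_d, unit_sphere eta ->
    'I_d.-1 -> bloch_branch mu eta;
  branch_orthonormal : forall (eta : 'cV[R]_d) (heta : unit_sphere eta),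
    (forall m m' : 'I_d.-1,
       dotv (branch_phi0 (branch heta m)) (branch_phi0 (branch heta m'))
       = (m == m')%:R) /\
    (forall m : 'I_d.-1, dotv (branch_phi0 (branch heta m)) eta = 0)
}.

Definition same_propagation_relation (R : realType) (d : nat)
    (mu : d.-tuple R -> R) (S : bloch_data mu) (A B : tensor4 R d) : Prop :=
  forall (eta : 'cV[R]_d) (heta : unit_sphere eta) (m : 'I_d.-1),
    Mmx eta A *m branch_phi0 (branch S heta m) =
    Mmx eta B *m branch_phi0 (branch S heta m).

(* Main.v *)
Require Import Defs.
From mathcomp Require Import all_boot all_order all_algebra.
From mathcomp Require Import all_classical all_reals all_analysis.
From mathcomp Require Import ring lra.

Set Implicit Arguments.
Unset Strict Implicit.
Unset Printing Implicit Defensive.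

Import GRing.Theory.

Local Open Scope ring_scope.

(** Put [C = B - A].  The propagation relations agree exactly when, for every
    unit vector [eta], the matrix [Mmx eta C] annihilates the vectors
    [branch_phi0]; these form an orthonormal basis of the orthogonal complement
    of [eta], so this says that [Mmx eta C] annihilates that complement
    ([mulmx_eq0_orthogonal]).

    If [C = c I (x) I + N], then [Mmx eta C = c eta eta^T], because the
    quadratic form of [N] in [eta] vanishes by antisymmetry; and [eta eta^T]
    annihilates the complement of [eta].

    Conversely, [Mmx x C] is quadratic in [x], so by homogeneity it annihilates
    the complement of [x] for every vector [x].  Testing it on
    [x_m e_l - x_l e_m] gives the polynomial identity
    [(Mmx x C)_(kl) x_m = (Mmx x C)_(km) x_l] ([annihilating_minors]).  It is
    enough to evaluate it at [x = e_i], which determines the entries of [C]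
    with equal lower indices up to one scalar for each [i], and at
    [x = e_i + e_j] and [x = e_i - e_j], which determines the part of [C]
    symmetric in its lower indices and identifies the scalars of [i] and [j]
    ([annihilating_diag_const], [annihilating_sym]).  Hence [C - c I (x) I] is
    antisymmetric in its lower indices, and the simple symmetry turns this
    into antisymmetry in the upper ones. *)

(** * Quadratic matrices of tensors *)

Section TensorMatrix.
Variables (R : realType) (d : nat).
Implicit Types (C N : tensor4 R d) (x y eta : 'cV[R]_d).

Definition annihilates_orthogonal C x :=
  forall v, dotv v x = 0 -> Mmx x C *m v = 0.

Lemma MmxB x A B :
  Mmx x (fun k l a b => B k l a b - A k l a b) = Mmx x B - Mmx x A.
Proof.
apply/matrixP => k l; rewrite !mxE -sumrB; apply: eq_bigr => a _.
by rewrite -sumrB; apply: eq_bigr => b _; rewrite -!mulrBl.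
Qed.

Lemma MmxZ x C (t : R) : Mmx (t *: x) C = t ^+ 2 *: Mmx x C.
Proof.
apply/matrixP => k l; rewrite !mxE big_distrr; apply: eq_bigr => a _ /=.
by rewrite big_distrr; apply: eq_bigr => b _ /=; rewrite !mxE; ring.
Qed.

Lemma Mmx_tensor_II x : Mmx x (@tensor_II R d) = x *m x^T.
Proof.
apply/matrixP => k l; rewrite !mxE big_ord1 mxE (bigD1 k) //=.
rewrite (bigD1 l) //= /tensor_II !eqxx !mul1r big1 => [|b /negPf bl]; last first.
  by rewrite bl mulr0 !mul0r.
rewrite big1 ?addr0 // => a /negPf ak.
by apply: big1 => b _; rewrite ak !mul0r.
Qed.

Lemma Mmx_decomp x C N c :
  (forall k l a b, C k l a b = c * tensor_II R k l a b + N k l a b) ->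
  Mmx x C = c *: (x *m x^T) + Mmx x N.
Proof.
move=> defC; rewrite -Mmx_tensor_II; apply/matrixP => k l; rewrite !mxE.
rewrite big_distrr -big_split; apply: eq_bigr => a _ /=.
by rewrite big_distrr -big_split; apply: eq_bigr => b _ /=; rewrite defC; ring.
Qed.

Lemma Mmx_alternating x N :
  (forall k l a b, N k l a b = - N k l b a) -> Mmx x N = 0.
Proof.
move=> altN; apply/matrixP => k l; rewrite !mxE.
set s := LHS.
have sN : s = - s.
  rewrite {1}/s exchange_big -sumrN; apply: eq_bigr => b _.
  by rewrite -sumrN; apply: eq_bigr => a _; rewrite (altN k l a b); ring.
lra.
Qed.

Lemma Mmx_two_axes C (i j k l : 'I_d) (t : R) :
  Mmx (delta_mx i 0 + t *: delta_mx j 0) C k l =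
  C k l i i + t * (C k l i j + C k l j i) + t ^+ 2 * C k l j j.
Proof.
have pick (F : 'I_d -> R) h : \sum_a F a * (a == h)%:R = F h.
  rewrite (bigD1 h) //= eqxx mulr1 big1 ?addr0 // => a /negPf ->.
  by rewrite mulr0.
have xE h : (delta_mx i 0 + t *: delta_mx j 0 : 'cV[R]_d) h 0
    = (h == i)%:R + t * (h == j)%:R by rewrite !mxE eqxx !andbT.
pose G a := C k l a i + t * C k l a j.
rewrite mxE (eq_bigr (fun a => G a * (a == i)%:R + t * G a * (a == j)%:R)).
  by rewrite big_split /= !pick /G; ring.
move=> a _; pose r := (a == i)%:R + t * (a == j)%:R.
rewrite (eq_bigr (fun b => C k l a b * r * (b == i)%:R
                         + t * C k l a b * r * (b == j)%:R)).
  by rewrite big_split /= !pick /G /r; ring.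
by move=> b _; rewrite !xE /r; ring.
Qed.

Lemma Mmx_axis C (i k l : 'I_d) : Mmx (delta_mx i 0) C k l = C k l i i.
Proof. by have := Mmx_two_axes C i i k l 0; rewrite scale0r addr0 => ->; ring. Qed.

(** * From unit vectors to all vectors *)

Lemma dotvE x y : dotv x y = (y^T *m x) 0 0.
Proof. by rewrite mxE; apply: eq_bigr => i _; rewrite mxE mulrC. Qed.

Lemma dotvZr (t : R) x y : dotv x (t *: y) = t * dotv x y.
Proof. by rewrite /dotv big_distrr; apply: eq_bigr => i _ /=; rewrite mxE; ring. Qed.

Lemma dotvZl (t : R) x y : dotv (t *: x) y = t * dotv x y.
Proof. by rewrite /dotv big_distrr; apply: eq_bigr => i _ /=; rewrite mxE; ring. Qed.

Lemma dotv_ge0 x : 0 <= dotv x x.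
Proof. by apply: Num.Theory.sumr_ge0 => i _; rewrite -expr2 Num.Theory.sqr_ge0. Qed.

Lemma dotv_eq0 x : dotv x x = 0 -> x = 0.
Proof.
move=> /eqP; rewrite Num.Theory.psumr_eq0 => [/allP x0|i _]; last first.
  by rewrite -expr2 Num.Theory.sqr_ge0.
apply/matrixP => i j; rewrite ord1 mxE; apply/eqP.
by have := x0 i (mem_index_enum i); rewrite /= mulf_eq0 orbb.
Qed.

Lemma annihilates_unit_sphere C :
  (forall eta, unit_sphere eta -> annihilates_orthogonal C eta) ->
  forall x, annihilates_orthogonal C x.
Proof.
move=> annC x v vx.
have [x0|x0] := eqVneq (dotv x x) 0.
  have -> : x = 0 *: x by rewrite (dotv_eq0 x0) scaler0.
  by rewrite MmxZ expr0n scale0r mul0mx.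
pose r := Num.sqrt (dotv x x).
have r2 : r ^+ 2 = dotv x x by rewrite Num.Theory.sqr_sqrtr ?dotv_ge0.
have r0 : r != 0 by rewrite -sqrf_eq0 r2.
have -> : x = r *: (r^-1 *: x) by rewrite scalerA mulfV ?scale1r.
rewrite MmxZ -scalemxAl annC ?scaler0 //; last by rewrite dotvZr vx mulr0.
by rewrite /unit_sphere /= dotvZr dotvZl -r2; field.
Qed.

(** * Tensors whose matrix annihilates the orthogonal complement *)

(** These relations say that each row of [Mmx x C] is proportional to [x]; they
    are polynomial in [x], which is what allows an evaluation at well chosen
    points. *)
Lemma annihilating_minors C x (k l m : 'I_d) :
  annihilates_orthogonal C x -> Mmx x C k l * x m 0 = Mmx x C k m * x l 0.
Proof.
have dotd (i : 'I_d) y : dotv (delta_mx i 0) y = y i 0.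
  rewrite /dotv (bigD1 i) //= mxE !eqxx mul1r big1 ?addr0 // => a /negPf ai.
  by rewrite mxE ai mul0r.
have mxd (M : 'M[R]_d) (i : 'I_d) :
    (M *m (delta_mx i 0 : 'cV[R]_d)) k 0 = M k i by rewrite -colE mxE.
move=> /(_ (x m 0 *: delta_mx l 0 - x l 0 *: delta_mx m 0)).
have -> : dotv (x m 0 *: delta_mx l 0 - x l 0 *: delta_mx m 0) x = 0.
  rewrite dotvE mulmxBr mxE [X in _ + X]mxE -!dotvE !dotvZl !dotd; ring.
move=> /(_ erefl) /matrixP /(_ k 0).
rewrite mulmxBr -!scalemxAr mxE [X in _ + X]mxE [X in X - _]mxE.
rewrite [X in _ - X]mxE !mxd [X in _ = X]mxE => /eqP.
by rewrite subr_eq0 => /eqP; rewrite ![x _ 0 * _]mulrC.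
Qed.

Section Annihilating.
Variable C : tensor4 R d.
Hypotheses (symC : simple_symmetry C)
  (annC : forall x, annihilates_orthogonal C x).

Let axis_eq0 (i k l : 'I_d) : l != i -> C k l i i = 0.
Proof.
move=> /negPf li; have := annihilating_minors k l i (@annC (delta_mx i 0)).
by rewrite !Mmx_axis !mxE li !eqxx mulr0 mulr1.
Qed.

Let axisE (i k l : 'I_d) :
  C k l i i = C i i i i * ((i == k)%:R * (i == l)%:R).
Proof.
have [<-|il] := eqVneq i l; last by rewrite !mulr0 axis_eq0 1?eq_sym.
have [<-|ik] := eqVneq i k; first by rewrite !mulr1.
by rewrite symC axis_eq0 1?eq_sym // mul0r mulr0.
Qed.

(** The relations of [annihilating_minors] at [e_i + t e_j] for [t = 1] and
    [t = -1]: adding and subtracting the two values separates the terms of even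
    degree in [t] from those of odd degree. *)
Let off_axis (i j k : 'I_d) : i != j ->
  C k i i j + C k i j i = C k j i i + C k j j j.
Proof.
move=> /negPf ij.
have minor t :=
  annihilating_minors k j i (@annC (delta_mx i 0 + t *: delta_mx j 0)).
have := (minor 1, minor (-1)); rewrite !Mmx_two_axes !mxE !eqxx (eq_sym j i) !ij /=.
by case; lra.
Qed.

Let off_axis_eq0 (i j k l : 'I_d) : i != j -> l != i -> l != j ->
  C k l i j + C k l j i = 0.
Proof.
move=> /negPf ij li lj.
have := annihilating_minors k l i (@annC (delta_mx i 0 + 1 *: delta_mx j 0)).
rewrite !Mmx_two_axes (axis_eq0 _ li) (axis_eq0 _ lj) !mxE !eqxx.
by rewrite (negPf li) (negPf lj) ij /=; lra.
Qed.

(** Both scalars equal [C i j i j + C i j j i]: [off_axis] computes this sum, up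
    to the simple symmetry, with the roles of [i] and [j] in either order. *)
Lemma annihilating_diag_const (i j : 'I_d) : C i i i i = C j j j j.
Proof.
have [->//|ij] := eqVneq i j.
have ji : j != i by rewrite eq_sym.
have := off_axis j ij; have := off_axis i ji.
rewrite (axis_eq0 _ ij) (axis_eq0 _ ji).
by rewrite (symC i j j i) (symC i j i j); lra.
Qed.

Lemma annihilating_diag (i0 i k l : 'I_d) :
  C k l i i = C i0 i0 i0 i0 * tensor_II R k l i i.
Proof. by rewrite axisE (annihilating_diag_const i0 i). Qed.

(** A pair [a != b] reduces to equal lower indices by [off_axis] when [l] is one
    of them; otherwise both sides vanish. *)
Lemma annihilating_sym (i0 k l a b : 'I_d) :
  C k l a b + C k l b a =
  C i0 i0 i0 i0 * (tensor_II R k l a b + tensor_II R k l b a).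
Proof.
have [<-|ab] := eqVneq a b.
  by rewrite (annihilating_diag i0) mulrDr.
have ba : b != a by rewrite eq_sym.
have [->|la] := eqVneq l a.
  rewrite (off_axis k ab) (annihilating_diag i0 a) (annihilating_diag i0 b).
  by rewrite /tensor_II !eqxx (negPf ab) (negPf ba); ring.
have [->|lb] := eqVneq l b.
  rewrite addrC (off_axis k ba) (annihilating_diag i0 a) (annihilating_diag i0 b).
  by rewrite /tensor_II !eqxx (negPf ab) (negPf ba); ring.
rewrite (off_axis_eq0 k ab la lb) /tensor_II.
by rewrite !(eq_sym _ l) (negPf la) (negPf lb) !mulr0 addr0 mulr0.
Qed.

End Annihilating.
End TensorMatrix.

(** * Orthonormal families *)

(** The rows [eta^T, phi_0^T, ...] form a square matrix with [P P^T = 1], hence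
    also [P^T P = 1]; so [M v = (M P^T) (P v)], where only the first block of
    [M P^T] and only the second block of [P v] can be nonzero. *)
Lemma mulmx_eq0_orthogonal (R : realType) (n : nat) (eta : 'cV[R]_n.+1)
    (phi : 'I_n -> 'cV[R]_n.+1) (M : 'M[R]_n.+1) (v : 'cV[R]_n.+1) :
  dotv eta eta = 1 ->
  (forall m m', dotv (phi m) (phi m') = (m == m')%:R) ->
  (forall m, dotv (phi m) eta = 0) ->
  (forall m, M *m phi m = 0) ->
  dotv v eta = 0 -> M *m v = 0.
Proof.
move=> eta1 phi1 phi_eta Mphi v_eta.
pose F : 'M[R]_(n, n.+1) := \matrix_(m, i) phi m i 0.
pose P : 'M[R]_(1 + n) := col_mx eta^T F.
have etaF : eta^T *m F^T = 0.
  apply/rowP => m; rewrite mxE [RHS]mxE -[RHS](phi_eta m).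
  by apply: eq_bigr => i _; rewrite !mxE mulrC.
have PP : P *m P^T = 1%:M.
  rewrite tr_col_mx mul_col_row trmxK etaF -[F *m eta]trmxK trmx_mul etaF trmx0.
  have -> : eta^T *m eta = 1%:M.
    by apply/matrixP => i j; rewrite !ord1 -dotvE eta1 mxE eqxx.
  have -> : F *m F^T = 1%:M.
    apply/matrixP => m m'; rewrite mxE [RHS]mxE -phi1.
    by apply: eq_bigr => i _; rewrite !mxE.
  by rewrite -scalar_mx_block.
have MF : M *m F^T = 0.
  apply/matrixP => k m; have /matrixP/(_ k 0) := Mphi m.
  rewrite !mxE => Mk; rewrite -[RHS]Mk.
  by apply: eq_bigr => i _; rewrite !mxE.
rewrite -[v](mul1mx) -(mulmx1C PP) -mulmxA mulmxA tr_col_mx mul_mx_row trmxK MF.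
rewrite mul_col_mx mul_row_col mul0mx addr0.
suff -> : eta^T *m v = 0 by rewrite mulmx0.
by apply/matrixP => i j; rewrite !ord1 -dotvE v_eta mxE.
Qed.

(** * Equality of propagation relations *)

Theorem proposition4p1 (R : realType) (d : nat) (hd : (0 < d)%N)
    (mu : d.-tuple R -> R) (hmu : viscosity mu) (S : bloch_data mu)
    (A B : tensor4 R d) (hA : simple_symmetry A) (hB : simple_symmetry B) :
  same_propagation_relation S A B <->
  exists (c : R) (N : tensor4 R d),
    [/\ simple_symmetry N,
        antisymmetry_property N &
        forall k l a b : 'I_d,
          B k l a b - A k l a b = c * tensor_II R k l a b + N k l a b].
Proof.
case: d hd mu hmu S A B hA hB => // n _ mu _ S A B hA hB.
pose C : tensor4 R n.+1 := fun k l a b => B k l a b - A k l a b.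
split=> [same|[c [N [_ [altN diagN] defC]]] eta heta m]; last first.
  have [_ phi_eta] := branch_orthonormal S heta.
  apply/esym/subr0_eq; rewrite -mulmxBl -MmxB (Mmx_decomp eta defC).
  rewrite [Mmx eta N]Mmx_alternating ?addr0 => [|k l a b].
    rewrite -scalemxAl -mulmxA (_ : eta^T *m _ = 0) ?mulmx0 ?scaler0 //.
    by apply/matrixP => i j; rewrite !ord1 -dotvE phi_eta mxE.
  (* The antisymmetry property exempts the indices that are all equal; there
     the entry of [N] is zero. *)
  have [[<- [<- <-]]|neq] := pselect (k = l /\ k = a /\ k = b).
    by rewrite diagN oppr0.
  have [] // := altN k l a b.
  by case=> -[ak bl] [bk _]; case: neq; rewrite -bl bk ak.
have symC : simple_symmetry C by move=> k l a b; rewrite /C hA hB.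
have annC : forall x, annihilates_orthogonal C x.
  apply: annihilates_unit_sphere => eta heta v v_eta.
  have [phi1 phi_eta] := branch_orthonormal S heta.
  apply: (mulmx_eq0_orthogonal (phi := fun m => branch_phi0 (branch S heta m)))
    v_eta => // m.
  by rewrite MmxB mulmxBl same subrr.
pose c := C 0 0 0 0.
pose N : tensor4 R n.+1 := fun k l a b => C k l a b - c * tensor_II R k l a b.
have symN : simple_symmetry N.
  by move=> k l a b; rewrite /N symC /tensor_II; ring.
have altN k l a b : N k l a b = - N k l b a.
  have := annihilating_sym symC annC 0 k l a b; rewrite /N /c; lra.
exists c, N; split=> // [|k l a b]; last by rewrite /N /C; ring.
split=> [j l a b _|i]; first by rewrite -altN symN -altN.
by have := altN i i i i; lra.
Qed.
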